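(* For every positive integer $n$ and every permutation $w$ in the symmetric group $S_n$, $$\frac{1}{2}\,|L_2(w)| \;\leq\; \operatorname{diam}(G(w)).$$
   Context: The symmetric group $S_n$ is the Coxeter group (type $A_{n-1}$) generated by the adjacent transpositions $s_1,\dots,s_{n-1}$, $s_i=(i\ \ i{+}1)$, with $m_{ij}$ the order of $s_is_j$. A reduced word of $w$ is an expression $s_{i_1}\cdots s_{i_\ell}$ of $w$ of minimal length. Graph $G(w)$: the vertices are the reduced words of $w$. Two reduced words are joined by an edge when they differ by a single application of one of the Coxeter relations $s_is_j\cdots = s_js_i\cdots$ ($m_{ij}$ letters on each side, $i\ne j$), replacing a consecutive factor. This graph is connected. $\operatorname{diam}(G(w))$ is the maximum graph distance between two of its vertices. Set $L_2(w)$: let $\Phi^+=\{e_j-e_i : 1\le i<j\le n\}$ be the positive roots. The Coxeter arrangement $\mathcal{A}$ consists of the hyperplanes $H_\alpha=\{x:\langle x,\alpha\rangle=0\}$, $\alpha\in\Phi^+$ (in $\mathbb{R}^n$, or in the hyperplane of vectors with coordinate sum zero, so as to make the arrangement essential). Its chambers are the connected components of the complement of the union of the hyperplanes. They are labelled by elements of $S_n$: the identity labels the fundamental chamber $C=\{x:\langle x,\alpha\rangle>0\ \forall\alpha\in\Phi^+\}$, and $w$ labels $wC$. Let $L_2$ be the set of codimension-two subspaces that are intersections of hyperplanes in $\mathcal{A}$. Then $L_2(w)$ is the set of $X\in L_2$ such that the images of the chambers $C$ and $wC$ in the localized arrangement $\mathcal{A}_X=\{H/X : H\in\mathcal{A},\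 H\supset X\}$ are antipodal (i.e. every hyperplane $H\in\mathcal{A}$ with $H\supset X$ separates $C$ from $wC$). *)

(* Defs.v *)
From HB Require Import structures.
From mathcomp Require Import all_boot all_order all_algebra all_fingroup.
From mathcomp Require Import finmap boolp classical_sets reals ereal.

Set Implicit Arguments.
Unset Strict Implicit.
Unset Printing Implicit Defensive.

Import Order.TTheory GRing.Theory Num.Theory.

Local Open Scope fset_scope.
Local Open Scope classical_set_scope.
Local Open Scope ring_scope.

Section ReducedWords.
Variable n : nat.

Definition word := seq 'I_n.-1.

Lemma ltn_adj (i : 'I_n.-1) : (i.+1 < n)%N.
Proof. by rewrite -ltn_predRL. Qed.

Definition adj_transp (i : 'I_n.-1) : 'S_n :=
  tperm (Ordinal (ltnW (ltn_adj i))) (Ordinal (ltn_adj i)).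

(* The product s_{i_1} ... s_{i_l} for composition of functions, rightmost
   factor applied first; the group law of 'S_n applies the leftmost factor
   first, hence the reversal. *)
Definition word_perm (u : word) : 'S_n := (\prod_(i <- rev u) adj_transp i)%g.

Definition reduced (w : 'S_n) : set word :=
  [set u | word_perm u = w /\
           forall v : word, word_perm v = w -> (size u <= size v)%N].

Definition cox_m (i j : 'I_n.-1) : nat := #[(adj_transp i * adj_transp j)%g]%g.

(* i j i j ... with m letters *)
Definition alternating (i j : 'I_n.-1) (m : nat) : word :=
  mkseq (fun k => if odd k then j else i) m.

Definition coxeter_move (u v : word) : Prop :=
  exists (p q : word) (i j : 'I_n.-1),
    [/\ i != j,
        u = p ++ alternating i j (cox_m i j) ++ q
      & v = p ++ alternating j i (cox_m i j) ++ q].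

Definition word_edge (w : 'S_n) : rel word :=
  fun u v => `[< [/\ reduced w u, reduced w v & coxeter_move u v] >].

End ReducedWords.

Section GraphDiameter.
Variables (R : realType) (T : eqType).

(* Least length of a walk from x to y; +oo when there is none. *)
Definition graph_dist (e : rel T) (x y : T) : \bar R :=
  ereal_inf [set (size p)%:R%:E | p in [set p | path e x p /\ last x p = y]].

Definition graph_diam (V : set T) (e : rel T) : \bar R :=
  ereal_sup [set graph_dist e p.1 p.2 | p in V `*` V].

End GraphDiameter.

Definition diamG (R : realType) (n : nat) (w : 'S_n) : \bar R :=
  graph_diam R (reduced w) (word_edge w).

Section CoxeterArrangement.
Variables (R : realType) (n : nat).

Definition dot (x y : 'rV[R]_n) : R := \sum_(k < n) x 0 k * y 0 k.

Definition hyperplane (a : 'rV[R]_n) : {vspace 'rV[R]_n} :=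
  lker (linfun (mulmxr a^T)).

Lemma mem_hyperplane (a x : 'rV[R]_n) : (x \in hyperplane a) = (dot x a == 0).
Proof.
rewrite memv_ker lfunE /=; have -> : dot x a = (x *m a^T) 0 0.
  by rewrite mxE; apply: eq_bigr => k _; rewrite mxE.
apply/eqP/eqP => [->|xa0]; first by rewrite mxE.
by apply/matrixP => i j; rewrite !ord1 xa0 mxE.
Qed.

Definition pos_roots : {fset 'rV[R]_n} :=
  [fset (delta_mx 0 p.2 - delta_mx 0 p.1 : 'rV[R]_n)
     | p in [pred p : 'I_n * 'I_n | (p.1 < p.2)%N]].

Definition arrangement : {fset {vspace 'rV[R]_n}} :=
  [fset hyperplane a | a in pos_roots].

Definition fund_chamber : set 'rV[R]_n :=
  [set x | forall a, a \in pos_roots -> 0 < dot x a].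

(* Left action of 'S_n on row vectors with w e_i = e_(w i), that is
   (w x)_j = x_(w^-1 j). *)
Definition perm_act (w : 'S_n) (x : 'rV[R]_n) : 'rV[R]_n := col_perm w^-1%g x.

Definition chamber (w : 'S_n) : set 'rV[R]_n := perm_act w @` fund_chamber.

(* The normal vector a is determined up to a nonzero scalar, so either set may
   be on either side of H. *)
Definition separates (H : {vspace 'rV[R]_n}) (A B : set 'rV[R]_n) : Prop :=
  exists a : 'rV[R]_n,
    [/\ H = hyperplane a,
        forall x, A x -> 0 < dot x a
      & forall y, B y -> dot y a < 0].

Definition L2 : {fset {vspace 'rV[R]_n}} :=
  [fset X in [fset (\bigcap_(H <- B) H)%VS
                | B : {fset {vspace 'rV[R]_n}} in fpowerset arrangement]
     | (\dim X + 2 == n)%N].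

Definition L2_of (w : 'S_n) : {fset {vspace 'rV[R]_n}} :=
  [fset X in L2
     | `[< forall H, H \in arrangement -> (X <= H)%VS ->
             separates H fund_chamber (chamber w) >]].

End CoxeterArrangement.

(* Main.v *)
Require Import Defs.
From mathcomp Require Import all_boot all_order all_algebra all_fingroup.
From mathcomp Require Import finmap boolp classical_sets reals ereal.
From mathcomp Require Import cyclic zify.

Set Implicit Arguments.
Unset Strict Implicit.
Unset Printing Implicit Defensive.

(** ** Why the bound holds

Reading a word [u] from left to right and applying its letters to the one-line
notation of the identity, every letter exchanges two adjacent values; let the
crossings of [u] be the resulting sequence of pairs of values.  For a reduced
word of [w] it lists each inversion of [w] once.  A Coxeter move reverses a
block of this sequence, made either of two pairs or of the three pairs inside
a three-element set.

A member of [L2_of w] is the intersection of the hyperplanes of two inversions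
[(a, b)] and [(c, d)] of [w]; either these are disjoint, or three values are
involved and all three pairs of them are inversions.  In both cases there is a
presentation with [a < b], [c < d], [a < c] and [b <> d] (the triple
[x < y < z] being presented by [(x, y)] and [(y, z)]), which is called a code
below.  There are at least [#|L2_of w|] codes ([card_L2_of]).  A move changes
the relative order of the two pairs of at most one code
([coxeter_move_reversed]), so that the distance between two reduced words is at
least the number of codes whose order differs between them
([reversed_le_diam]).

It remains to find reduced words that disagree on many codes.  An order on the
inversions of [w] comes from a reduced word as soon as its initial segments are
inversion sets, which is a condition on triples of values ([realize_order]).
This allows building [w] by inserting the values in increasing or in decreasing
order, or by filling the positions of the one-line notation from the left or
from the right.
The first two words disagree on every code except those with [c < d < b], that
is, nested as intervals of values ([value_words]); the last two disagree on
every code except those nested as intervals of positions ([position_words]).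
For a code that is nested in both ways, exchanging [b] and [d] yields a code
that is nested in neither, and this exchange is injective.  Hence the two
numbers of disagreements add up to at least the number of codes
([codes_le_reversed]), and the larger of them is at least half of it. *)
(** * Words, the pairs that they cross, and Coxeter moves *)

Section Crossings.
Import GroupScope.
Variable n : nat.
Implicit Types (s w : 'S_n) (u v : word n) (i j : 'I_n.-1).

Definition lo i : 'I_n := Ordinal (ltnW (ltn_adj i)).
Definition hi i : 'I_n := Ordinal (ltn_adj i).

Lemma adj_val i (k : 'I_n) :
  adj_transp i k =
    (if k == i :> nat then i.+1
     else if k == i.+1 :> nat then nat_of_ord i else k) :> nat.
Proof.
rewrite /adj_transp; case: tpermP => [->|->|/eqP + /eqP] /=; rewrite ?eqxx //.
  by rewrite (gtn_eqF (ltnSn i)).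
by rewrite -!val_eqE /= => /negPf-> /negPf->.
Qed.

Lemma adj_inv i : (adj_transp i)^-1 = adj_transp i.
Proof. exact: tpermV. Qed.

Lemma adj_lo i : adj_transp i (lo i) = hi i. Proof. exact: tpermL. Qed.
Lemma adj_hi i : adj_transp i (hi i) = lo i. Proof. exact: tpermR. Qed.

Lemma word_perm_cons i u : word_perm (i :: u) = word_perm u * adj_transp i.
Proof. by rewrite /word_perm rev_cons -cats1 big_cat /= big_seq1. Qed.

Lemma word_perm_cat u v : word_perm (u ++ v) = word_perm v * word_perm u.
Proof. by rewrite /word_perm rev_cat big_cat. Qed.

Lemma adj_commute i j : i.+1 < j ->
  adj_transp i * adj_transp j = adj_transp j * adj_transp i.
Proof.
move=> ij; apply/permP=> k; apply/val_inj; rewrite /= !permM !adj_val.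
by repeat case: ifP; lia.
Qed.

Lemma adj_braid i j : j = i.+1 :> nat ->
  adj_transp i * (adj_transp j * adj_transp i)
  = adj_transp j * (adj_transp i * adj_transp j).
Proof.
move=> ij; apply/permP=> k; apply/val_inj; rewrite /= !permM !adj_val.
by repeat case: ifP; lia.
Qed.

Lemma adj_mul_neq1 i j : i != j -> adj_transp i * adj_transp j != 1.
Proof.
apply: contra => /eqP/permP /(_ (lo i)); rewrite permM adj_lo perm1.
move/(congr1 val) => /= /eqP; rewrite -val_eqE adj_val /=.
by repeat case: ifP; lia.
Qed.

Lemma adj_sq i : adj_transp i * adj_transp i = 1.
Proof. exact: tperm2. Qed.

Lemma cox_mC i j : cox_m i j = cox_m j i.
Proof. by rewrite /cox_m -[in RHS]orderV invMg !adj_inv. Qed.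

Lemma ltn_neq i j : i < j -> i != j.
Proof. by rewrite -val_eqE /=; lia. Qed.

Lemma cox_m_far i j : i.+1 < j -> cox_m i j = 2.
Proof.
move=> ij; apply: nt_prime_order => //; last first.
  by apply: adj_mul_neq1; apply: ltn_neq; lia.
rewrite expgS expg1 [X in X * _]adj_commute // -mulgA [X in _ * X]mulgA.
rewrite adj_sq mul1g.
exact: adj_sq.
Qed.

Lemma cox_m_near i j : j = i.+1 :> nat -> cox_m i j = 3.
Proof.
move=> ij; apply: nt_prime_order => //; last first.
  by apply: adj_mul_neq1; apply: ltn_neq; lia.
rewrite 2!expgS expg1; set x := adj_transp i; set y := adj_transp j.
have braid : x * (y * x) = y * (x * y) := adj_braid ij.
have -> : x * y * (x * y * (x * y)) = x * (y * x) * (y * (x * y)).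
  by rewrite !mulgA.
rewrite -braid -!mulgA [X in _ * (_ * X)]mulgA adj_sq mul1g.
by rewrite [X in _ * X]mulgA adj_sq mul1g adj_sq.
Qed.

(** A non-reduced word may exchange a pair that is already inverted, so a
    crossing is recorded as the increasing pair of the two values. *)
Definition norm_pair (a b : 'I_n) := if a < b then (a, b) else (b, a).

(** The letters of [u] act on the positions of the one-line notation of [s],
    hence by multiplication on the left in the group law of ['S_n]. *)
Fixpoint crossings s u : seq ('I_n * 'I_n) :=
  if u is i :: u' then
    norm_pair (s (lo i)) (s (hi i)) :: crossings (adj_transp i * s) u'
  else [::].

Lemma crossings_cat s u v :
  crossings s (u ++ v) = crossings s u ++ crossings (word_perm u * s) v.
Proof.
elim: u s => [|i u IHu] s /=; first by rewrite /word_perm big_nil mul1g.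
by rewrite IHu word_perm_cons mulgA.
Qed.

Lemma size_crossings s u : size (crossings s u) = size u.
Proof. by elim: u s => //= i u IHu s; rewrite IHu. Qed.

(** The two pairs either are disjoint or satisfy [k.1.2 = k.2.1].  In the first
    case [k.1.1 < k.2.1] selects one of the two orderings of the pairs; in the
    second, [k] stands for the triple [k.1.1 < k.1.2 < k.2.2].  Two pairs of a
    triple that share their smaller or their larger element are excluded, so
    that each triple has exactly one code. *)
Definition rank2_code (k : ('I_n * 'I_n) * ('I_n * 'I_n)) :=
  [&& k.1.1 < k.1.2, k.2.1 < k.2.2, k.1.1 < k.2.1 & k.1.2 != k.2.2].

(** This is what makes the reversal of a block of crossings affect one code at
    most. *)
Definition rigid (l : seq ('I_n * 'I_n)) := forall k k',
  rank2_code k -> rank2_code k' -> k.1 \in l -> k.2 \in l ->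
  k'.1 \in l -> k'.2 \in l -> k = k'.

Lemma rigid_pair (p q : 'I_n * 'I_n) : rigid [:: p; q].
Proof.
move=> [P Q] [P' Q'] /and4P[/= _ _ PQ _] /and4P[/= _ _ PQ' _].
rewrite !inE => /orP[]/eqP EP /orP[]/eqP EQ /orP[]/eqP EP' /orP[]/eqP EQ';
  subst P Q P' Q' => //; lia.
Qed.

(** Of the three pairs inside a three-element set, only the one made of the two
    smallest elements and the one made of the two largest form a code. *)
Lemma rigid_triangle (a b c : 'I_n) : uniq [:: a; b; c] ->
  rigid [:: norm_pair a b; norm_pair a c; norm_pair b c].
Proof.
rewrite /= !inE !negb_or -!andbA => /and4P[ab ac bc _].
have abn : (a : nat) <> b by move/val_inj/eqP; apply/negP.
have acn : (a : nat) <> c by move/val_inj/eqP; apply/negP.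
have bcn : (b : nat) <> c by move/val_inj/eqP; apply/negP.
suff H : exists k0, forall k, rank2_code k ->
    k.1 \in [:: norm_pair a b; norm_pair a c; norm_pair b c] ->
    k.2 \in [:: norm_pair a b; norm_pair a c; norm_pair b c] -> k = k0.
  by case: H => k0 H k k' hk hk' h1 h2 h1' h2'; rewrite (H k) // (H k').
have code4 x y z t : rank2_code ((x, y), (z, t)) =
    [&& x < y, z < t, x < z & y != t] by [].
rewrite /norm_pair; case: (ltnP a b) => lab; case: (ltnP a c) => lac;
 case: (ltnP b c) => lbc; try lia;
 [exists ((a, b), (b, c)) | exists ((a, c), (c, b)) | exists ((c, a), (a, b))
 |exists ((b, a), (a, c)) | exists ((b, c), (c, a)) | exists ((c, b), (b, a))];
 move=> [P Q] + /=; rewrite !inE => + /or3P[]/eqP E1 /or3P[]/eqP E2;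
 rewrite E1 E2 code4 ?eqxx //=; lia.
Qed.

Lemma index_cat3 (T : eqType) (P : T) (l1 l2 l3 : seq T) :
  index P (l1 ++ l2 ++ l3) =
  if P \in l1 then index P l1
  else size l1 + (if P \in l2 then index P l2 else size l2 + index P l3).
Proof. by rewrite !index_cat. Qed.

(** Reversing a block of a sequence keeps the entries of the block at the same
    side of everything else, so only the order of two entries of the block can
    change. *)
Lemma index_rev_infix (T : eqType) (P Q : T) (l1 l2 l3 : seq T) :
  ~~ ((P \in l2) && (Q \in l2)) ->
  (index P (l1 ++ rev l2 ++ l3) < index Q (l1 ++ rev l2 ++ l3)) =
  (index P (l1 ++ l2 ++ l3) < index Q (l1 ++ l2 ++ l3)).
Proof.
rewrite !index_cat3 !mem_rev size_rev.
have bound1 (R : T) : R \in l1 -> index R l1 < size l1 by rewrite index_mem.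
have bound2 (R : T) : R \in l2 -> index R l2 < size l2 by rewrite index_mem.
have bound_rev (R : T) : R \in l2 -> index R (rev l2) < size l2.
  by rewrite -mem_rev -size_rev index_mem.
case: (boolP (P \in l1)) => [/bound1 ? |_];
  case: (boolP (Q \in l1)) => [/bound1 ? | _] //=;
  case: (boolP (P \in l2)) => [P2|_]; case: (boolP (Q \in l2)) => [Q2|_] //= _;
  try (move: (bound2 _ P2) (bound_rev _ P2) => ? ?);
  try (move: (bound2 _ Q2) (bound_rev _ Q2) => ? ?); lia.
Qed.

(** Distant generators exchange two pairs that do not interact, and the braid
    relation [i j i = j i j] performs the three exchanges of three adjacent
    values in the two possible orders. *)
Lemma move_crossings s i j : i != j ->
  let u := alternating i j (cox_m i j) in
  let v := alternating j i (cox_m i j) in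
  [/\ word_perm u = word_perm v, crossings s v = rev (crossings s u)
    & rigid (crossings s u)].
Proof.
wlog ij : i j / i < j => [H|_].
  move=> nij; have [/H/(_ nij)//|ji|/val_inj/eqP] := ltngtP i j; last first.
    by rewrite (negPf nij).
  have [E1 E2 E3] := H j i ji (ltn_neq ji).
  rewrite cox_mC; split=> //; first by rewrite E2 revK.
  by move=> k k'; rewrite E2 !mem_rev; apply: E3.
have [ij1|ij1] := ltnP i.+1 j.
  rewrite cox_m_far //= /alternating /mkseq /=; split.
  - by rewrite !word_perm_cons /word_perm big_nil !mul1g (adj_commute ij1).
  - have [E1 E2 E3 E4] :
        [/\ adj_transp i (lo j) = lo j, adj_transp i (hi j) = hi j,
        adj_transp j (lo i) = lo i & adj_transp j (hi i) = hi i].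
      by split; apply/ord_inj; rewrite adj_val /=; repeat case: ifP; lia.
    by rewrite /rev /= !permM E1 E2 E3 E4.
  - exact: rigid_pair.
have {ij1} ij1 : j = i.+1 :> nat by lia.
have lo_j : lo j = hi i by apply/val_inj.
have hi_j_fix : adj_transp i (hi j) = hi j.
  by apply/ord_inj; rewrite adj_val /=; repeat case: ifP; lia.
have lo_i_fix : adj_transp j (lo i) = lo i.
  by apply/ord_inj; rewrite adj_val /=; repeat case: ifP; lia.
have [jlo jhi] : adj_transp j (hi i) = hi j /\ adj_transp j (hi j) = hi i.
  by rewrite -lo_j adj_lo adj_hi.
rewrite cox_m_near //= /alternating /mkseq /=; split.
- by rewrite !word_perm_cons /word_perm big_nil !mul1g -!mulgA adj_braid.
- rewrite /rev /= !permM lo_j.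
  by rewrite !(adj_lo, adj_hi, hi_j_fix, lo_i_fix, jlo, jhi, lo_j).
- rewrite !permM lo_j !(adj_lo, adj_hi, hi_j_fix, lo_i_fix, jlo, jhi, lo_j).
  apply: rigid_triangle; rewrite /= !inE !(inj_eq perm_inj) -!val_eqE /=; lia.
Qed.

Definition crosses_before u (k : ('I_n * 'I_n) * ('I_n * 'I_n)) :=
  index k.1 (crossings 1 u) < index k.2 (crossings 1 u).

Definition reversed (K : {set ('I_n * 'I_n) * ('I_n * 'I_n)}) u v :=
  [set k in K | crosses_before u k != crosses_before v k].

Lemma coxeter_move_reversed (K : {set ('I_n * 'I_n) * ('I_n * 'I_n)}) u v :
  {in K, forall k, rank2_code k} ->
  coxeter_move u v -> #|reversed K u v| <= 1.
Proof.
move=> codeK [p [q [i [j [ij -> ->]]]]].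
have [Eperm Erev rig] := move_crossings (word_perm p) ij.
apply/card_le1_eqP => k k'; rewrite !inE /crosses_before !crossings_cat !mulg1.
rewrite Erev Eperm => /andP[kK + /andP[k'K +]].
have in_infix (c : ('I_n * 'I_n) * ('I_n * 'I_n)) l1 l2 l3 :
    (index c.1 (l1 ++ l2 ++ l3) < index c.2 (l1 ++ l2 ++ l3)) !=
    (index c.1 (l1 ++ rev l2 ++ l3) < index c.2 (l1 ++ rev l2 ++ l3)) ->
    (c.1 \in l2) /\ (c.2 \in l2).
  move=> H; apply/andP; apply: contraNT H => /index_rev_infix ->.
  by rewrite eqxx.
move=> /in_infix[? ?] /in_infix[? ?].
by apply: rig => //; apply: codeK.
Qed.

End Crossings.

(** * Inversion sets and words with a prescribed order of inversions *)

Section Inversions.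
Import GroupScope.
Variable n : nat.
Implicit Types (s w : 'S_n) (u v : word n) (i j : 'I_n.-1).

Definition inverted s (P : 'I_n * 'I_n) :=
  (P.1 < P.2) && (s^-1 P.2 < s^-1 P.1).

Lemma inverted1 P : inverted 1 P = false.
Proof. by rewrite /inverted invg1 !perm1; lia. Qed.

(** Exchanging two adjacent positions only affects the relative position of the
    two values found there. *)
Lemma inverted_adj s i P : P != norm_pair (s (lo i)) (s (hi i)) ->
  inverted (adj_transp i * s) P = inverted s P.
Proof.
case: P => a b; rewrite /inverted /norm_pair invMg adj_inv !permM /=.
have [lab|] //= := ltnP a b.
move: (s^-1 a) (s^-1 b) (permKV s a) (permKV s b) => x y Ex Ey nP.
have xy : x != y by apply: contraL lab => /eqP E; rewrite -Ex -Ey E ltnn.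
suff [] : ~~ ((x == lo i) && (y == hi i)) /\ ~~ ((x == hi i) && (y == lo i)).
  by move: xy; rewrite -!val_eqE /= !adj_val; repeat case: ifP; lia.
split; apply: contra nP => /andP[/eqP Ex' /eqP Ey'].
  by rewrite -Ex' -Ey' Ex Ey lab.
by rewrite -Ex' -Ey' Ex Ey ifN // -leqNgt ltnW.
Qed.

Lemma inverted_crossings s u P : inverted (word_perm u * s) P ->
  inverted s P || (P \in crossings s u).
Proof.
elim: u s => [|i u IHu] s; first by rewrite /word_perm big_nil mul1g => ->.
rewrite word_perm_cons -mulgA => /IHu /orP[|in_u]; last first.
  by rewrite /= inE in_u !orbT.
rewrite /= inE; case: eqVneq => [->|nP]; rewrite ?orbT //.
by rewrite inverted_adj // => ->.
Qed.

(** Every inversion has to be crossed at least once, which is the lower bound on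
    the length used to certify that a word is reduced. *)
Lemma inversions_le_size v : #|[set P | inverted (word_perm v) P]| <= size v.
Proof.
rewrite -(size_crossings 1) (leq_trans _ (card_size _)) // subset_leq_card //.
apply/fintype.subsetP => P; rewrite inE -[X in inverted X]mulg1.
by move/inverted_crossings; rewrite inverted1.
Qed.

(** The position of a value is the number of values before it, and the inversion
    set determines which values these are. *)
Lemma inverted_inj s w : inverted s =1 inverted w -> s = w.
Proof.
move=> eq_sw.
have pos_card (t : 'S_n) (x : 'I_n) : #|[set y | t^-1 y < t^-1 x]| = t^-1 x.
  have -> : [set y | t^-1 y < t^-1 x] = t @: [set k : 'I_n | k < t^-1 x].
    apply/setP => y; rewrite inE; apply/idP/imsetP => [yx|[k + ->]].
      by exists (t^-1 y); rewrite ?inE ?permKV.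
    by rewrite inE permK.
  rewrite card_imset; last exact: perm_inj.
  have := big_ord_widen (idx := 0) (op := addn) n (fun=> 1%N)
    (ltnW (ltn_ord (t^-1 x))).
  rewrite big_const_ord iter_addn_0 mul1n => E; rewrite [RHS]E -sum1_card.
  by apply: eq_bigl => k; rewrite inE.
apply/invg_inj/permP => x; apply/ord_inj; rewrite -(pos_card s) -(pos_card w).
apply: eq_card => y; rewrite !inE.
have [yx|xy|/ord_inj->] := ltngtP y x; last by rewrite !ltnn.
- move: (eq_sw (y, x)); rewrite /inverted /= yx /=.
  have neq (t : 'S_n) : t^-1 y != t^-1 x :> nat.
    by rewrite (inj_eq val_inj) (inj_eq perm_inj) -val_eqE /=; lia.
  by move: (neq s) (neq w); lia.
- by move: (eq_sw (x, y)); rewrite /inverted /= xy /=.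
Qed.

Section Realization.
Variables (w : 'S_n) (key : 'I_n * 'I_n -> nat).
Hypothesis key_inj : injective key.
Hypothesis key_coclosed : forall a b c : 'I_n,
  a < b -> b < c -> inverted w (a, c) ->
  (inverted w (a, b) && (key (a, b) < key (a, c))) ||
  (inverted w (b, c) && (key (b, c) < key (a, c))).
Hypothesis key_closed : forall a b c : 'I_n,
  inverted w (a, b) -> inverted w (b, c) ->
  (key (a, c) < key (a, b)) || (key (a, c) < key (b, c)).

(** Let [s] have as inversions those of [w] that precede [(a, b)], and suppose
    that a value [c] lies between [a] and [b] in the one-line notation of [s].
    If [a < c < b], then neither [(a, c)] nor [(c, b)] precedes [(a, b)],
    contrary to [key_coclosed].  If [c] is outside the interval from [a] to [b],
    then [c] forms with one end of it an inversion of [s], and [key_closed]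
    puts the pair formed with the other end before [(a, b)] as well, although
    [s] does not invert it. *)
Lemma next_inversion_adjacent s a b : inverted w (a, b) ->
  (forall P, inverted s P = inverted w P && (key P < key (a, b))) ->
  s^-1 b = (s^-1 a).+1 :> nat.
Proof.
move=> inv_ab inv_s.
have lab : a < b by case/andP: inv_ab.
have sab : s^-1 a < s^-1 b.
  have: s^-1 a != s^-1 b :> nat.
    by rewrite (inj_eq val_inj) (inj_eq perm_inj) -val_eqE /=; lia.
  by move: (inv_s (a, b)); rewrite ltnn andbF /inverted /= lab /=; lia.
apply/eqP; rewrite eqn_leq sab andbT leqNgt; apply/negP => far.
pose c := s (Ordinal (ltn_trans far (ltn_ord _))).
have sc : s^-1 c = (s^-1 a).+1 :> nat by rewrite /c permK.
have sinv (x y : 'I_n) : x < y -> inverted s (x, y) = (s^-1 y < s^-1 x).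
  by move=> xy; rewrite /inverted /= xy.
have trans x y z : inverted w (x, y) -> inverted w (y, z) -> inverted w (x, z).
  by rewrite /inverted /= => /andP[? ?] /andP[? ?]; lia.
have nac : a != c :> nat by apply: contra_eqN sc => /eqP/ord_inj <-; lia.
have nbc : b != c :> nat by apply: contra_eqN sc => /eqP/ord_inj <-; lia.
have [ac|ca|E] := ltngtP a c; last by rewrite E eqxx in nac.
- have [cb|bc|E] := ltngtP c b; last by rewrite E eqxx in nbc.
  + case/orP: (key_coclosed ac cb inv_ab); rewrite -inv_s sinv //; lia.
  + have: inverted s (b, c) by rewrite sinv //; lia.
    rewrite inv_s => /andP[inv_bc key_bc].
    have: inverted s (a, c).
      rewrite inv_s (trans _ _ _ inv_ab inv_bc) /=.
      by case/orP: (key_closed inv_ab inv_bc) => // /ltn_trans; apply.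
    rewrite sinv //; lia.
- have: inverted s (c, a) by rewrite sinv //; lia.
  rewrite inv_s => /andP[inv_ca key_ca].
  have: inverted s (c, b).
    rewrite inv_s (trans _ _ _ inv_ca inv_ab) /=.
    by case/orP: (key_closed inv_ca inv_ab) => // /ltn_trans; apply.
  rewrite sinv //; lia.
Qed.

(** The word is built one inversion at a time: the next inversion occupies
    adjacent positions, so a single letter performs it.  Keys that are not the
    key of an inversion contribute no letter. *)
Lemma realize_below t : exists u,
  [/\ forall P, inverted (word_perm u) P = inverted w P && (key P < t),
      forall P, (P \in crossings 1 u) = inverted w P && (key P < t)
    & sorted (relpre key ltn) (crossings 1 u)].
Proof.
elim: t => [|t [u [inv_u mem_u sorted_u]]].
  exists [::]; split=> // P; rewrite ?ltn0 ?andbF //.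
  by rewrite /word_perm big_nil inverted1.
have ltS P : (key P < t.+1) = (key P < t) || (key P == t).
  by rewrite ltnS leq_eqVlt orbC.
have [/existsP[[a b] /andP[inv_ab /eqP key_ab]]|] :=
  boolP [exists P, inverted w P && (key P == t)]; last first.
  rewrite negb_exists => /forallP no_t; exists u.
  split=> // P; rewrite ?inv_u ?mem_u ltS; move: (no_t P);
    by case: inverted; rewrite //= => /negPf->; rewrite orbF.
have is_ab P : (key P == t) = (P == (a, b)) by rewrite -key_ab (inj_eq key_inj).
have adj : (word_perm u)^-1 b = ((word_perm u)^-1 a).+1 :> nat.
  by apply: next_inversion_adjacent => //; rewrite key_ab.
have lt_i : (word_perm u)^-1 a < n.-1 by rewrite ltn_predRL -adj.
pose i : 'I_n.-1 := Ordinal lt_i.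
have sV_lo : (word_perm u)^-1 a = lo i by apply/ord_inj.
have sV_hi : (word_perm u)^-1 b = hi i by apply/ord_inj.
have s_lo : word_perm u (lo i) = a by rewrite -sV_lo permKV.
have s_hi : word_perm u (hi i) = b by rewrite -sV_hi permKV.
have lab : a < b by case/andP: inv_ab.
have cross : crossings 1 (u ++ [:: i]) = rcons (crossings 1 u) (a, b).
  by rewrite crossings_cat /= mulg1 s_lo s_hi /norm_pair lab cats1.
exists (u ++ [:: i]); split.
- move=> P; rewrite word_perm_cat word_perm_cons.
  rewrite [word_perm [::]]big_nil mul1g.
  rewrite ltS is_ab; have [->|nP] := eqVneq P (a, b).
    rewrite orbT andbT inv_ab /inverted /= lab invMg !permM adj_inv /=.
    by rewrite sV_lo sV_hi adj_lo adj_hi; apply: ltnSn.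
  rewrite inverted_adj ?s_lo ?s_hi /norm_pair ?lab // inv_u.
  by rewrite orbF.
- move=> P; rewrite cross mem_rcons inE mem_u ltS is_ab.
  by case: eqVneq => [->|]; rewrite ?inv_ab ?orbT ?orbF.
- rewrite cross; case: (crossings 1 u) sorted_u mem_u => //= P l sorted_l mem_l.
  rewrite rcons_path sorted_l /= key_ab.
  by have := mem_l (last P l); rewrite mem_last => /esym/andP[].
Qed.

(** Total orders on the inversions of [w] whose initial segments are closed and
    coclosed are exactly those given by reduced words; this is the direction
    from orders to words. *)
Lemma realize_order : exists u, reduced w u /\
  {in inverted w &, forall P Q,
    (index P (crossings 1 u) < index Q (crossings 1 u)) = (key P < key Q)}.
Proof.
have [u [inv_u mem_u sorted_u]] := realize_below (\max_P key P).+1.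
have lt_max P : key P < (\max_P key P).+1 by rewrite ltnS leq_bigmax.
have {inv_u} wu : word_perm u = w.
  by apply: inverted_inj => P; rewrite inv_u lt_max andbT.
have {}mem_u P : (P \in crossings 1 u) = inverted w P.
  by rewrite mem_u lt_max andbT.
have tr : transitive (relpre key ltn) by move=> ? ? ?; apply: ltn_trans.
have irr : irreflexive (relpre key ltn) by move=> ?; apply: ltnn.
exists u; split.
  split=> // v wv; rewrite -(size_crossings 1) -(card_uniqP _); last first.
    exact: sorted_uniq sorted_u.
  rewrite (leq_trans _ (inversions_le_size v)) // subset_leq_card //.
  by apply/fintype.subsetP => P; rewrite inE mem_u wv.
move=> P Q invP invQ; apply/idP/idP.
  by apply: (sorted_ltn_index tr sorted_u); rewrite mem_u.
move=> PQ; rewrite ltnNge; apply/negP; rewrite leq_eqVlt => /orP[/eqP E|].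
  have EPQ : Q = P.
    rewrite -(nth_index P (s := crossings 1 u) (x := Q)) ?mem_u //.
    by rewrite E nth_index // mem_u.
  by rewrite EPQ ltnn in PQ.
move/(sorted_ltn_index tr sorted_u); rewrite !mem_u => /(_ invQ invP) /=; lia.
Qed.

End Realization.

End Inversions.

(** * Two pairs of reduced words that are far apart *)

Lemma ltn_lex n (f1 f2 g1 g2 : nat) : g1 < n -> g2 < n ->
  (f1 * n + g1 < f2 * n + g2) = (f1 < f2) || ((f1 == f2) && (g1 < g2)).
Proof.
move=> g1n g2n; have [f12|f21|->] := ltngtP f1 f2 => /=.
- by have := leq_mul f12 (leqnn n); rewrite mulSn; lia.
- by have := leq_mul f21 (leqnn n); rewrite mulSn; lia.
- by rewrite ltn_add2l.
Qed.

Section DistantWords.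
Import GroupScope.
Variable n : nat.
Implicit Types (s w : 'S_n) (u v : word n) (i j : 'I_n.-1).
Implicit Types (K : {set ('I_n * 'I_n) * ('I_n * 'I_n)}).

(** The second component being smaller than [n], this encodes the lexicographic
    order on [(f P, g P)] in [nat]. *)
Definition lex_key (f g : 'I_n * 'I_n -> 'I_n) (P : 'I_n * 'I_n) : nat :=
  f P * n + g P.

Lemma lex_keyE f g P Q : (lex_key f g P < lex_key f g Q) =
  (f P < f Q) || ((f P == f Q :> nat) && (g P < g Q)).
Proof. exact: ltn_lex. Qed.

Lemma lex_key_inj f g : (forall P Q, f P = f Q -> g P = g Q -> P = Q) ->
  injective (lex_key f g).
Proof.
move=> fg_inj P Q E; have := lex_keyE f g P Q; have := lex_keyE f g Q P.
by rewrite E ltnn => ? ?; apply: fg_inj; apply/ord_inj; lia.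
Qed.

(** If [a < b < c] appear in reverse order in [w], such a key orders their pairs
    as [(a, b)], [(a, c)], [(b, c)].  It covers both the insertion of the values
    in increasing order, where an inversion is ranked first by its larger value,
    and the filling of the positions from the right, where it is ranked first by
    the position of its smaller value. *)
Lemma realize_by_larger w (key : 'I_n * 'I_n -> nat) : injective key ->
  (forall P Q : 'I_n * 'I_n, P != Q ->
     P.2 <= Q.2 -> w^-1 Q.1 <= w^-1 P.1 -> key P < key Q) ->
  exists u, reduced w u /\
  {in inverted w &, forall P Q,
    (index P (crossings 1 u) < index Q (crossings 1 u)) = (key P < key Q)}.
Proof.
move=> key_inj mono; apply: realize_order => // a b c.
  move=> ab bc /andP[/= _ pca].
  have [pba|pab] := ltnP (w^-1 b) (w^-1 a).
    rewrite {1}/inverted /= ab pba mono //= ?xpair_eqE -?val_eqE /=; lia.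
  apply/orP; right; rewrite {1}/inverted /= bc mono //=;
    rewrite ?xpair_eqE -?val_eqE /=; lia.
move=> /andP[/= ab pba] /andP[/= bc pcb].
apply/orP; right; rewrite mono //= ?xpair_eqE -?val_eqE /=; lia.
Qed.

(** The mirror image of [realize_by_larger]: a triple appearing in reverse order
    is crossed as [(b, c)], [(a, c)], [(a, b)].  It covers the insertion of the
    values in decreasing order and the filling of the positions from the
    left. *)
Lemma realize_by_smaller w (key : 'I_n * 'I_n -> nat) : injective key ->
  (forall P Q : 'I_n * 'I_n, P != Q ->
     Q.1 <= P.1 -> w^-1 P.2 <= w^-1 Q.2 -> key P < key Q) ->
  exists u, reduced w u /\
  {in inverted w &, forall P Q,
    (index P (crossings 1 u) < index Q (crossings 1 u)) = (key P < key Q)}.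
Proof.
move=> key_inj mono; apply: realize_order => // a b c.
  move=> ab bc /andP[/= _ pca].
  have [pbc|pcb] := leqP (w^-1 b) (w^-1 c).
    apply/orP; left; rewrite {1}/inverted /= ab mono //=;
      rewrite ?xpair_eqE -?val_eqE /=; lia.
  apply/orP; right; rewrite {1}/inverted /= bc mono //=;
    rewrite ?xpair_eqE -?val_eqE /=; lia.
move=> /andP[/= ab pba] /andP[/= bc pcb].
apply/orP; left; rewrite mono //= ?xpair_eqE -?val_eqE /=; lia.
Qed.

Definition rank2_codes w : {set ('I_n * 'I_n) * ('I_n * 'I_n)} :=
  [set k | [&& inverted w k.1, inverted w k.2 & rank2_code k]].

Lemma neq_pos w (a b : 'I_n) : a != b -> w^-1 a != w^-1 b :> nat.
Proof. by rewrite (inj_eq val_inj) (inj_eq perm_inj). Qed.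

(** The first word ranks inversions by increasing larger value, the second one
    by decreasing smaller value.  The second one thus always crosses the second
    pair of a code first, and the first one does so unless [k.1.2 < k.2.2]. *)
Lemma value_words w : exists u v, [/\ reduced w u, reduced w v
  & {in rank2_codes w, forall k,
      (crosses_before u k != crosses_before v k) = (k.1.2 < k.2.2)}].
Proof.
pose f (P : 'I_n * 'I_n) := P.2; pose g (P : 'I_n * 'I_n) := rev_ord (w^-1 P.1).
have [|P Q nPQ PQ2 PQ1|u [red_u ord_u]] := @realize_by_larger w (lex_key f g).
- apply: lex_key_inj => -[a b] [c d]; rewrite /f /g /=.
  by move=> -> /rev_ord_inj/perm_inj ->.
- rewrite lex_keyE /f /g; move: nPQ PQ2 PQ1;
    case: P Q => a b [c d] /=; rewrite xpair_eqE -!val_eqE /=.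
  move=> nPQ bd pca; have := @neq_pos w a c; rewrite -val_eqE /=.
  move: (ltn_ord (w^-1 a)) (ltn_ord (w^-1 c)); lia.
pose f' (P : 'I_n * 'I_n) := rev_ord P.1; pose g' (P : 'I_n * 'I_n) := w^-1 P.2.
have [|P Q nPQ PQ1 PQ2|v [red_v ord_v]] :=
  @realize_by_smaller w (lex_key f' g').
- apply: lex_key_inj => -[a b] [c d]; rewrite /f' /g' /=.
  by move=> /rev_ord_inj-> /perm_inj ->.
- rewrite lex_keyE /f' /g'; move: nPQ PQ1 PQ2;
    case: P Q => a b [c d] /=; rewrite xpair_eqE -!val_eqE /=.
  move=> nPQ bd pca; have := @neq_pos w b d; rewrite -val_eqE /=.
  move: (ltn_ord a) (ltn_ord c); lia.
exists u, v; split=> // -[[a b] [c d]]; rewrite inE /= => /and3P[inv1 inv2].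
rewrite /rank2_code /crosses_before /= => /and4P[ab cd ac bd].
rewrite ord_u ?ord_v // !lex_keyE /f /g /f' /g' /=.
move: bd (ltn_ord a) (ltn_ord c); rewrite -val_eqE /=; lia.
Qed.

(** The first word ranks inversions by decreasing position of the smaller value,
    the second one by increasing position of the larger value.  They agree on a
    code exactly when one of its pairs lies inside the other as an interval of
    positions. *)
Lemma position_words w : exists u v, [/\ reduced w u, reduced w v
  & {in rank2_codes w, forall k,
      (crosses_before u k != crosses_before v k) =
      ((w^-1 k.1.2 < w^-1 k.2.2) == (w^-1 k.1.1 < w^-1 k.2.1))}].
Proof.
pose f (P : 'I_n * 'I_n) := rev_ord (w^-1 P.1); pose g (P : 'I_n * 'I_n) := P.2.
have [|P Q nPQ PQ2 PQ1|u [red_u ord_u]] := @realize_by_larger w (lex_key f g).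
- apply: lex_key_inj => -[a b] [c d]; rewrite /f /g /=.
  by move=> /rev_ord_inj/perm_inj -> ->.
- rewrite lex_keyE /f /g; move: nPQ PQ2 PQ1;
    case: P Q => a b [c d] /=; rewrite xpair_eqE -!val_eqE /=.
  move=> nPQ bd pca; have := @neq_pos w a c; rewrite -val_eqE /=.
  move: (ltn_ord (w^-1 a)) (ltn_ord (w^-1 c)); lia.
pose f' (P : 'I_n * 'I_n) := w^-1 P.2; pose g' (P : 'I_n * 'I_n) := rev_ord P.1.
have [|P Q nPQ PQ1 PQ2|v [red_v ord_v]] :=
  @realize_by_smaller w (lex_key f' g').
- apply: lex_key_inj => -[a b] [c d]; rewrite /f' /g' /=.
  by move=> /perm_inj-> /rev_ord_inj ->.
- rewrite lex_keyE /f' /g'; move: nPQ PQ1 PQ2;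
    case: P Q => a b [c d] /=; rewrite xpair_eqE -!val_eqE /=.
  move=> nPQ bd pca; have := @neq_pos w b d; rewrite -val_eqE /=.
  move: (ltn_ord a) (ltn_ord c); lia.
exists u, v; split=> // -[[a b] [c d]]; rewrite inE /= => /and3P[inv1 inv2].
rewrite /rank2_code /crosses_before /= => /and4P[ab cd ac bd].
rewrite ord_u ?ord_v // !lex_keyE /f /g /f' /g' /=.
have := neq_pos w bd; have := @neq_pos w a c; rewrite -val_eqE /=.
move: (ltn_ord (w^-1 a)) (ltn_ord (w^-1 c)); lia.
Qed.

Lemma in_reversed K u v k : (k \in reversed K u v) =
  (k \in K) && (crosses_before u k != crosses_before v k).
Proof. by rewrite inE. Qed.

(** A code on which both pairs of words agree is nested both in value and in
    position.  Exchanging the larger elements of its two pairs gives a code that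
    is nested in neither way, on which both pairs of words disagree. *)
Lemma codes_le_reversed w u1 v1 u2 v2 :
  let K := rank2_codes w in
  {in K, forall k, (crosses_before u1 k != crosses_before v1 k) =
      (k.1.2 < k.2.2)} ->
  {in K, forall k, (crosses_before u2 k != crosses_before v2 k) =
      ((w^-1 k.1.2 < w^-1 k.2.2) == (w^-1 k.1.1 < w^-1 k.2.1))} ->
  #|K| <= #|reversed K u1 v1| + #|reversed K u2 v2|.
Proof.
move=> K sep1 sep2; set S1 := reversed K u1 v1; set S2 := reversed K u2 v2.
rewrite -cardsUI -(cardsID (S1 :|: S2) K).
apply: leq_add; first exact/subset_leq_card/subsetIr.
(* What is left are the codes nested both in value and in position. *)
pose exchange (k : ('I_n * 'I_n) * ('I_n * 'I_n)) :=
  ((k.1.1, k.2.2), (k.2.1, k.1.2)).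
have exch_inj : injective exchange.
  by move=> [[a b] [c d]] [[a' b'] [c' d']] [-> -> -> ->].
rewrite -(card_imset _ exch_inj) subset_leq_card //.
apply/fintype.subsetP => _ /imsetP[k + ->].
rewrite finset.in_setD finset.in_setU finset.in_setI !in_reversed negb_or.
move=> /andP[/andP[+ +] kK].
rewrite kK /= sep1 // sep2 // => n1 n2.
have [exK sep] : exchange k \in K /\ (k.2.2 < k.1.2) &&
    ((w^-1 k.2.2 < w^-1 k.1.2) == (w^-1 k.1.1 < w^-1 k.2.1)).
  move: kK n1 n2; case: k => [[a b] [c d]];
    rewrite !inE /inverted /rank2_code /=.
  move=> /and3P[/andP[_ pba] /andP[_ pdc] /and4P[ab cd ac bd]] db npos.
  have := neq_pos w bd; have := @neq_pos w a c.
  by move: bd; rewrite -!val_eqE /=; lia.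
by rewrite exK sep1 // sep2.
Qed.

Lemma path_reversed K w u p : {in K, forall k, rank2_code k} ->
  path (@word_edge n w) u p -> #|reversed K u (last u p)| <= size p.
Proof.
move=> codeK; elim: p u => [|x p IHp] u /=.
  move=> _; rewrite leqn0 cards_eq0; apply/eqP/setP => k.
  by rewrite !inE eqxx andbF.
move=> /andP[/asboolP[_ _ ux] /IHp le_p].
apply: (@leq_trans (#|reversed K u x| + #|reversed K x (last x p)|));
  last first.
  exact: (leq_add (coxeter_move_reversed codeK ux) le_p).
rewrite -cardsUI (leq_trans _ (leq_addr _ _)) // subset_leq_card //.
apply/fintype.subsetP => k; rewrite !inE => /andP[-> /=].
by do 3!case: crosses_before.
Qed.

Lemma reversed_le_diam (R : realType) K w u v :
  {in K, forall k, rank2_code k} -> reduced w u -> reduced w v ->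
  (#|reversed K u v|%:R%R%:E <= diamG R w)%E.
Proof.
move=> codeK red_u red_v; apply: le_ereal_sup_tmp.
exists (graph_dist R (@word_edge n w) u v).
  by exists (u, v).
apply: le_ereal_inf_tmp => _ [p [path_p <-] <-].
by rewrite lee_fin Num.Theory.ler_nat (path_reversed codeK path_p).
Qed.

End DistantWords.

(** * Codimension-two flats as pairs of inversions *)

Import Order.TTheory GRing.Theory Num.Theory.

Section Arrangement.
Local Open Scope ring_scope.
Variables (R : realType) (n : nat).
Implicit Types (w : 'S_n) (a b c d : 'I_n) (x : 'rV[R]_n).

Definition root a b : 'rV[R]_n := delta_mx 0 b - delta_mx 0 a.
Definition root_hyperplane (P : 'I_n * 'I_n) := hyperplane (root P.1 P.2).

Lemma dot_root x a b : dot x (root a b) = x 0 b - x 0 a.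
Proof.
have dot_delta c : \sum_(k < n) x 0 k * (delta_mx 0 c : 'rV[R]_n) 0 k = x 0 c.
  rewrite (bigD1 c) //= big1 => [|k /negPf kc];
    rewrite mxE !eqxx ?kc ?mulr1 ?addr0 //.
  by rewrite mulr0.
rewrite /dot -[X in _ = X - _]dot_delta -[X in _ = _ - X]dot_delta -sumrB.
by apply: eq_bigr => k _; rewrite !mxE mulrBr.
Qed.

Lemma mem_root_hyperplane x a b :
  (x \in root_hyperplane (a, b)) = (x 0 a == x 0 b).
Proof. by rewrite mem_hyperplane dot_root subr_eq0 eq_sym. Qed.

Lemma dim_fullv_row : \dim (fullv : {vspace 'rV[R]_n}) = n.
Proof. by rewrite dimvf /dim /= mul1n. Qed.

Lemma root_hyperplane_in a b :
  (a < b)%N -> root_hyperplane (a, b) \in arrangement R n.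
Proof.
move=> ab; apply/imfsetP; exists (root a b) => //.
by apply/imfsetP; exists (a, b).
Qed.

Lemma arrangementP H : H \in arrangement R n ->
  exists a b, (a < b)%N /\ H = root_hyperplane (a, b).
Proof.
move=> /imfsetP[r /imfsetP[[a b] /= ab ->] ->].
by exists a, b.
Qed.

Lemma dotZl (t : R) x y : dot (t *: x) y = t * dot x y.
Proof. by rewrite /dot mulr_sumr; apply: eq_bigr => k _; rewrite mxE mulrA. Qed.

Lemma dotBl x x' y : dot (x - x') y = dot x y - dot x' y.
Proof. by rewrite /dot -sumrB; apply: eq_bigr => k _; rewrite !mxE mulrBl. Qed.

(** With [rho] in the fundamental chamber and [w rho] in the chamber of [w], a
    suitable combination of both is orthogonal to the root.  If the root had a
    nonnegative product with [w rho], this combination would be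
    [s rho - t (w rho)] with [s >= 0] and [t > 0], on which a normal vector
    separating the two chambers is positive.  This avoids comparing that normal
    vector to the root. *)
Lemma separates_inverted w a b : (a < b)%N ->
  separates (root_hyperplane (a, b)) (@fund_chamber R n) (@chamber R n w) ->
  inverted w (a, b).
Proof.
move=> ab [al [Hal pos neg]].
(* The coordinates of [rho] increase, and those of [w rho] are the positions. *)
pose rho : 'rV[R]_n := \row_k (k : nat)%:R.
have rho_fund : @fund_chamber R n rho.
  move=> _ /imfsetP[[c d] /= cd ->]; rewrite dot_root !mxE subr_gt0 ltr_nat //.
have val_act k : perm_act w rho 0 k = ((w^-1)%g k : nat)%:R by rewrite !mxE.
have := pos _ rho_fund.
have /neg : @chamber R n w (perm_act w rho) by exists rho.
rewrite /inverted /= ab /=; set sig := perm_act w rho => neg_al pos_al.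
rewrite ltnNge; apply/negP => le_ab.
pose s := dot sig (root a b); pose t := dot rho (root a b).
have s_ge0 : 0 <= s by rewrite /s dot_root !val_act subr_ge0 ler_nat.
have t_gt0 : 0 < t by rewrite /t dot_root !mxE subr_gt0 ltr_nat.
have : s *: rho - t *: sig \in root_hyperplane (a, b).
  by rewrite mem_hyperplane dotBl !dotZl mulrC subrr.
rewrite Hal mem_hyperplane dotBl !dotZl subr_eq0 => /eqP E.
have : t * dot sig al < 0 by rewrite pmulr_rlt0.
by rewrite -E ltNge mulr_ge0 // ltW.
Qed.

Lemma dim_root_hyperplane a b :
  (a < b)%N -> (\dim (root_hyperplane (a, b))).+1 = n.
Proof.
move=> ab.
apply/eqP; rewrite eqn_leq; apply/andP; split.
  rewrite -[X in (_ < X)%N]dim_fullv_row ltn_neqAle dimvS ?subvf // andbT.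
  apply/eqP => /eqP; rewrite (dimv_leqif_eq (subvf _)) => /eqP full.
  have := memvf (delta_mx 0 a : 'rV[R]_n).
  rewrite -full mem_root_hyperplane !mxE !eqxx.
  by rewrite -val_eqE /= gtn_eqF // oner_eq0.
rewrite -[X in (X <= _)%N]dim_fullv_row.
rewrite -(limg_ker_dim (linfun (mulmxr (root a b)^T)) fullv) capfv.
have le1 (U : {vspace 'M[R]_1}) : (\dim U <= 1)%N.
  by rewrite -[X in (_ <= X)%N](dimvf 'M[R]_1) dimvS ?subvf.
by rewrite (leq_trans (leq_add (leqnn _) (le1 _))) // addn1.
Qed.

(** A flat of codimension two lies properly inside one of its hyperplanes, which
    is therefore not contained in some other one; the intersection of the two
    has the dimension of the flat. *)
Lemma L2_cap X : X \in L2 R n -> exists a b c d,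
  [/\ (a < b)%N, (c < d)%N, (a, b) != (c, d)
    & X = (root_hyperplane (a, b) :&: root_hyperplane (c, d))%VS].
Proof.
rewrite !inE /= => /andP[/imfsetP[B /= + ->] /eqP dimX].
rewrite fpowersetE => /fsubsetP subB.
set X0 := (\bigcap_(H <- B) H)%VS in dimX *.
have X0_le H : H \in B -> (X0 <= H)%VS.
  by move=> HB; rewrite /X0 (big_fsetD1 H) //= capvSl.
have le_X0 (U : {vspace 'rV[R]_n}) :
    (forall H, H \in B -> (U <= H)%VS) -> (U <= X0)%VS.
  move=> UB; rewrite /X0 big_seq.
  by apply: (big_ind (fun V => (U <= V)%VS)) => [|V W UV UW|H /UB];
    rewrite ?subvf ?subv_cap ?UV.
have ex_notle (U : {vspace 'rV[R]_n}) : (\dim X0 < \dim U)%N ->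
    exists2 H, H \in B & ~~ (U <= H)%VS.
  move=> lt_dim; apply: contrapT => no.
  move: lt_dim; rewrite ltnNge => /negP; apply.
  apply/dimvS/le_X0 => H HB; apply: contrapT => /negP nUH.
  by apply: no; exists H.
have [|H1 H1B _] := ex_notle fullv; first by rewrite dim_fullv_row; lia.
have [a [b [ab EH1]]] := arrangementP (subB _ H1B).
have dim1 := dim_root_hyperplane ab; rewrite -EH1 in dim1.
have [|H2 H2B nle] := ex_notle H1; first by lia.
have [c [d [cd EH2]]] := arrangementP (subB _ H2B).
exists a, b, c, d; split=> //.
  by apply: contraNneq nle => -[E1 E2]; rewrite EH1 EH2 E1 E2.
rewrite -EH1 -EH2; apply/eqP; rewrite eqEdim subv_cap !X0_le //=.
suff : (\dim (H1 :&: H2) < \dim H1)%N by lia.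
rewrite ltn_neqAle dimvS ?capvSl // andbT (dimv_leqif_eq (capvSl _ _)).
by apply: contraNneq nle => <-; rewrite capvSr.
Qed.

Definition code_space (k : ('I_n * 'I_n) * ('I_n * 'I_n)) :=
  (root_hyperplane k.1 :&: root_hyperplane k.2)%VS.

(** When the two hyperplanes share an index, the flat is [x_i = x_j = x_k] and
    lies in the hyperplanes of all three pairs.  These are thus all inversions,
    and the flat is also given by the two pairs that form a code. *)
Lemma L2_of_code w X : X \in L2_of R w ->
  exists2 k, k \in rank2_codes w & X = code_space k.
Proof.
move=> XL; have XL2 : X \in L2 R n by move: XL; rewrite !inE => /andP[].
move: XL; rewrite !inE => /andP[_ /asboolP sepX].
have invX a b : (a < b)%N -> (X <= root_hyperplane (a, b))%VS ->
    inverted w (a, b).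
  by move=> ab /(sepX _ (root_hyperplane_in ab))/(separates_inverted ab).
have {XL2} := L2_cap XL2.
have main a b c d : (a < b)%N -> (c < d)%N -> (a, b) != (c, d) -> (a <= c)%N ->
   (a == c -> (b <= d)%N) ->
   X = (root_hyperplane (a, b) :&: root_hyperplane (c, d))%VS ->
   exists2 k, k \in rank2_codes w & X = code_space k.
  move=> ab cd neq ac acbd EX.
  have memX x : (x \in X) = (x 0 a == x 0 b) && (x 0 c == x 0 d).
    by rewrite EX memv_cap !mem_root_hyperplane.
  have code a' b' c' d' :
      (a' < b')%N -> (c' < d')%N -> (a' < c')%N -> b' != d' ->
      (forall x, (x \in X) = (x 0 a' == x 0 b') && (x 0 c' == x 0 d')) ->
      exists2 k, k \in rank2_codes w & X = code_space k.
    move=> ab' cd' ac' bd' memX'; exists ((a', b'), (c', d')).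
      rewrite inE /rank2_code /= ab' cd' ac' bd' !andbT.
      apply/andP; split; apply: invX => //; apply/subvP => x;
        by rewrite memX' mem_root_hyperplane => /andP[].
    by apply/vspaceP => x; rewrite memv_cap !mem_root_hyperplane memX'.
  have [eac|nac] := eqVneq a c.
    subst c; have bd : (b < d)%N.
      by move: neq (acbd (eqxx _)); rewrite xpair_eqE eqxx /= -val_eqE /=; lia.
    apply: (code a b b d) => //; first by rewrite -val_eqE /=; lia.
    by move=> x; rewrite memX; case: eqP => //= ->.
  have lac : (a < c)%N by move: nac; rewrite -val_eqE /=; lia.
  have [ebd|nbd] := eqVneq b d; last exact: (code a b c d).
  subst d; apply: (code a c c b) => //; first by rewrite -val_eqE /=; lia.
  by move=> x; rewrite memX; case: (x 0 c =P x 0 b) => [->|]; rewrite ?andbF.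
move=> [a [b [c [d [ab cd neq EX]]]]].
have [ac|ca|/ord_inj eac] := ltngtP a c.
- apply: (main a b c d) => //; first exact: ltnW.
  by move/eqP=> E; rewrite E ltnn in ac.
- apply: (main c d a b) => //;
    [by rewrite eq_sym | exact: ltnW | | by rewrite capvC].
  by move/eqP=> E; rewrite E ltnn in ca.
- subst c; have [bd|/ltnW db] := leqP b d; first exact: (main a b a d).
  by apply: (main a d a b) => //; [rewrite eq_sym | rewrite capvC].
Qed.

Lemma card_L2_of w : (#|` L2_of R w| <= #|rank2_codes w|)%N.
Proof.
rewrite cardE -(size_map code_space) uniq_leq_size ?fset_uniq // => X.
by move=> /L2_of_code[k kK ->]; rewrite map_f // mem_enum.
Qed.

End Arrangement.

Theorem theorem1p1 (R : realType) (n : nat) (n_gt0 : (0 < n)%N) (w : 'S_n) :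
  ((2^-1 * #|` L2_of R w|%:R)%R%:E <= diamG R w)%E.
Proof.
have [u1 [v1 [red_u1 red_v1 sep1]]] := value_words w.
have [u2 [v2 [red_u2 red_v2 sep2]]] := position_words w.
have codeK : {in rank2_codes w, forall k, rank2_code k}.
  by move=> k; rewrite inE => /and3P[].
have le1 := reversed_le_diam R codeK red_u1 red_v1.
have le2 := reversed_le_diam R codeK red_u2 red_v2.
have := leq_trans (card_L2_of R w) (codes_le_reversed sep1 sep2).
move: le1 le2; set N1 := #|_|; set N2 := #|_|; set N := #|` _| => le1 le2 leN.
have [le12|/ltnW le21] := leqP N1 N2.
- apply: le_trans le2; rewrite lee_fin ler_pdivrMl // -natrM ler_nat; lia.
- apply: le_trans le1; rewrite lee_fin ler_pdivrMl // -natrM ler_nat; lia.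
Qed.
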